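(* Let $V=\{(a_1,a_2,\ldots)\mid a_i\in\mathbb{C},\ \sum_{i\ge1}|a_i|^2<\infty\}$ with quadratic form $f((a_1,a_2,\ldots))=\sum_{i\ge1}a_i^2$. Let $I$ be a set with cardinality equal to $\dim_{\mathbb{C}}V$, let $W$ be a complex vector space with basis $\{w_i\}_{i\in I}$, and let $g$ be the quadratic form on $W$ given by $g(\alpha_1w_{i_1}+\cdots+\alpha_nw_{i_n})=\sum_{k=1}^n\alpha_k^2$ for distinct $i_1,\ldots,i_n\in I$. Then the Clifford algebras $A=Cl(V,f)$ and $B=Cl(W,g)$ are not isomorphic.
   Context: For a quadratic form $f$ on a complex vector space $V$ (i.e. $f(\alpha v)=\alpha^2f(v)$ and $f(u,v)=f(u+v)-f(u)-f(v)$ bilinear), the Clifford algebra $Cl(V,f)$ is the unital associative $\mathbb{C}$-algebra generated by $V$ and $1$ subject to $v^2=f(v)\cdot1$ for all $v\in V$. (Both $A$ and $B$ are unital locally matrix algebras of the same uncountable dimension with Steinitz number $2^\infty$.) *)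

(* Defs.v *)
From HB Require Import structures.
From mathcomp Require Import all_boot all_algebra.
From mathcomp Require Import all_classical all_reals all_analysis.
From mathcomp Require Import complex.
Set Implicit Arguments. Unset Strict Implicit. Unset Printing Implicit Defensive.
Import GRing.Theory Num.Theory numFieldTopology.Exports numFieldNormedType.Exports.
Local Open Scope ring_scope.
Local Open Scope complex_scope.

Definition lin_indep (K : fieldType) (V : lmodType K) (I : Type) (b : I -> V) : Prop :=
  forall (n : nat) (idx : 'I_n -> I) (a : 'I_n -> K),
    injective idx -> \sum_(k < n) a k *: b (idx k) = 0 -> forall k, a k = 0.

Definition spans (K : fieldType) (V : lmodType K) (I : Type) (b : I -> V) : Prop :=
  forall v : V, exists (n : nat) (idx : 'I_n -> I) (a : 'I_n -> K),
    v = \sum_(k < n) a k *: b (idx k).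

(* Hamel basis; "|I| = dim V" is expressed as: V has a Hamel basis indexed by I. *)
Definition hamel_basis (K : fieldType) (V : lmodType K) (I : Type) (b : I -> V) : Prop :=
  lin_indep b /\ spans b.

Definition sq_summable (R : realType) (a : nat -> R[i]) : Prop :=
  cvgn (series (fun i => (@complex.Re R (a i)) ^+ 2 + (@complex.Im R (a i)) ^+ 2)).

Definition sum_sq (R : realType) (a : nat -> R[i]) : R[i] :=
  (limn (series (fun i => @complex.Re R (a i ^+ 2)))) +i* (limn (series (fun i => @complex.Im R (a i ^+ 2)))).

Definition is_clifford (K : fieldType) (V : lmodType K) (f : V -> K)
    (A : algType K) (iota : {linear V -> A}) : Prop :=
  (forall v, iota v * iota v = (f v)%:A) /\
  forall (D : algType K) (phi : {linear V -> D}),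
    (forall v, phi v * phi v = (f v)%:A) ->
    exists h : {lrmorphism A -> D},
      (forall v, h (iota v) = phi v) /\
      (forall h' : {lrmorphism A -> D}, (forall v, h' (iota v) = phi v) -> h' =1 h).

(* Main.v *)
Require Import Defs.
From HB Require Import structures.
From mathcomp Require Import all_boot all_order all_algebra.
From mathcomp Require Import all_classical all_reals all_analysis.
From mathcomp Require Import complex ring lra.
Set Implicit Arguments.
Unset Strict Implicit.
Unset Printing Implicit Defensive.
Import Order.TTheory GRing.Theory Num.Theory.
Import numFieldTopology.Exports numFieldNormedType.Exports.
Local Open Scope ring_scope.

(** Let [d n] be the n-th coordinate vector of l^2.  In A, an element of even
    parity that commutes with all [iA (d n)] is a scalar: it lies in the
    subalgebra generated by finitely many vectors, and since no nonzero vector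
    is orthogonal to every [d n], a linear combination [y] of the [d n] can be
    chosen that detects any one of these vectors and is orthogonal to the
    others; graded commutation with [iA y] removes that vector.  Hence the
    centralizer of the countable set [iA (d n)] has no anticommuting pair
    [x, y] with [x^2 = y^2 = -1].  In B, any countable set lies in the
    subalgebra generated by countably many [iB (w i)].  The dimension of l^2
    is uncountable (geometric sequences), so three indices [i, j, k] remain,
    and [w_i w_j], [w_j w_k] are such a pair. *)

(** * Subalgebras generated by a set *)

Inductive gen (K : fieldType) (A : algType K) (T : A -> Prop) : A -> Prop :=
| gen_scalar k : gen T k%:A
| gen_in x : T x -> gen T x
| gen_add x y : gen T x -> gen T y -> gen T (x + y)
| gen_mul x y : gen T x -> gen T y -> gen T (x * y).

Arguments gen_scalar {K A} T k.

Section Generated.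
Variables (K : fieldType) (A : algType K).
Implicit Types (T : A -> Prop) (x y : A).

Lemma gen_scale T k x : gen T x -> gen T (k *: x).
Proof. by move=> gx; rewrite -mulr_algl; apply: gen_mul => //; exact: gen_scalar. Qed.

Lemma gen_sum T n (F : 'I_n -> A) :
  (forall i, gen T (F i)) -> gen T (\sum_(i < n) F i).
Proof.
move=> gF; apply: big_ind => // [|x y]; last exact: gen_add.
by rewrite -(scale0r (1 : A)); exact: gen_scalar.
Qed.

Lemma gen_trans T T' x : (forall y, T y -> gen T' y) -> gen T x -> gen T' x.
Proof.
move=> TT'; elim=> [k|y /TT'//|y z _ gy _ gz|y z _ gy _ gz].
- exact: gen_scalar.
- exact: gen_add.
- exact: gen_mul.
Qed.

Lemma gen_sub T T' x : (forall y, T y -> T' y) -> gen T x -> gen T' x.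
Proof. by move=> TT'; apply: gen_trans => y /TT'; exact: gen_in. Qed.

Lemma gen_comm T x y : (forall z, T z -> GRing.comm x z) -> gen T y ->
  GRing.comm x y.
Proof.
move=> xT; elim=> [k|z /xT//|z t _ xz _ xt|z t _ xz _ xt].
- by rewrite /GRing.comm mulr_algl mulr_algr.
- exact: commrD.
- exact: commrM.
Qed.

Lemma gen_alg_closed T : GRing.subalg_closed [pred x : A | `[< gen T x >]].
Proof.
split=> [|k x y|x y]; rewrite !inE.
- by have := gen_scalar T 1; rewrite scale1r.
- by move=> gx gy; apply: gen_add gy; exact: gen_scale.
- exact: gen_mul.
Qed.

End Generated.

Section GeneratedSubalgebra.
Variables (K : fieldType) (A : algType K) (T : A -> Prop).

Definition gen_pred : {pred A} := [pred x : A | `[< gen T x >]].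

HB.instance Definition _ := GRing.isSubalgClosed.Build K A gen_pred (@gen_alg_closed K A T).

(** Packaged as an algebra so that it can be the target [D] of the universal property. *)
Record gen_alg := GenAlg { gen_val :> A; gen_valP : gen_val \in gen_pred }.

HB.instance Definition _ := [isSub for gen_val].
HB.instance Definition _ := [Choice of gen_alg by <:].
HB.instance Definition _ := [SubChoice_isSubAlgebra of gen_alg by <:].

Lemma gen_val_linear : linear gen_val.
Proof. by []. Qed.

HB.instance Definition _ :=
  GRing.isLinear.Build K gen_alg A *:%R gen_val gen_val_linear.

Lemma gen_val_monoid_morphism : monoid_morphism gen_val.
Proof. by []. Qed.

HB.instance Definition _ :=
  GRing.isMonoidMorphism.Build gen_alg A gen_val gen_val_monoid_morphism.

End GeneratedSubalgebra.

(** * Generation of a Clifford algebra by its vectors *)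

Section CliffordGenerated.
Variables (K : fieldType) (V : lmodType K) (A : algType K) (iota : {linear V -> A}).

Definition iota_image (S : V -> Prop) (x : A) : Prop := exists2 v, S v & x = iota v.

Lemma gen_iota v : iota v \in gen_pred (iota_image (fun _ => True)).
Proof. by apply/asboolP/gen_in; exists v. Qed.

Definition iota_gen v := GenAlg (gen_iota v).

Lemma iota_gen_linear : linear iota_gen.
Proof. by move=> k u v; apply: val_inj; rewrite /= linearP. Qed.

HB.instance Definition _ :=
  GRing.isLinear.Build K V (gen_alg (iota_image (fun _ => True))) *:%R iota_gen iota_gen_linear.

(** The universal property lifts [iota] to the generated subalgebra. Followed by the inclusion, the
    lift fixes every [iota v], so by uniqueness it is the identity of [A]. *)
Lemma clifford_gen f x : is_clifford f iota -> gen (iota_image (fun _ => True)) x.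
Proof.
move=> [iota2 univ].
have iota_gen2 v : iota_gen v * iota_gen v = (f v)%:A.
  by apply: val_inj; exact: iota2.
have [h [h_iota _]] := univ _ iota_gen iota_gen2.
have [h0 [_ h0_uniq]] := univ _ iota iota2.
pose vl : {lrmorphism gen_alg (iota_image (fun _ => True)) -> A} := @gen_val _ _ _.
pose vh : {lrmorphism A -> A} := vl \o h.
have vh_iota v : vh (iota v) = iota v by rewrite /= h_iota.
rewrite [x](h0_uniq idfun) // -(h0_uniq vh) //=.
by have /asboolP := gen_valP (h x).
Qed.

End CliffordGenerated.

Lemma gen_image_finite (K : fieldType) (I : Type) (A : algType K) (a : I -> A)
    (x : A) : gen (fun y => exists i, y = a i) x ->
  exists S : set I, finite_set S /\ gen (fun y => exists2 i, S i & y = a i) x.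
Proof.
elim=> [k|y [i ->]|y z _ [S [fS gS]] _ [S' [fS' gS']]|y z _ [S [fS gS]] _ [S' [fS' gS']]].
- by exists set0; split; [exact: finite_set0|exact: gen_scalar].
- by exists [set i]%classic; split; [exact: finite_set1|apply: gen_in; exists i].
- exists (S `|` S')%classic; split; first by rewrite finite_setU.
  by apply: gen_add; [apply: gen_sub gS|apply: gen_sub gS'];
    move=> _ [i Si ->]; exists i => //; [left|right].
- exists (S `|` S')%classic; split; first by rewrite finite_setU.
  by apply: gen_mul; [apply: gen_sub gS|apply: gen_sub gS'];
    move=> _ [i Si ->]; exists i => //; [left|right].
Qed.

(** * Normal form with respect to one vector *)

Section Peeling.
Variables (K : fieldType) (V : lmodType K) (A : algType K).
Variables (iota : {linear V -> A}) (f : V -> K).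
Hypothesis iota2 : forall v, iota v * iota v = (f v)%:A.

Definition polar u v := f (u + v) - f u - f v.

Lemma iota_anticomm u v : iota u * iota v = (polar u v)%:A - iota v * iota u.
Proof.
rewrite /polar !scalerBl -!iota2 linearD /=.
rewrite mulrDl !mulrDr; move: (_ * _) (_ * _) (_ * _) (_ * _) => a b c d.
by apply/esym/eqP; rewrite !subr_eq [c + d]addrC [b + a]addrC -!addrA [c + _]addrC
  -!addrA [a + (b + c)]addrCA.
Qed.

Definition seq_gen (s : seq V) := gen (iota_image iota (fun v => v \in s)).

(** Moving [iota u] to the left past one generator costs a sign and a scalar; induction extends this
    to products and sums. *)
Lemma seq_gen_commute s (u : V) x : seq_gen s x ->
  exists p1 p2, [/\ seq_gen s p1, seq_gen s p2 & x * iota u = iota u * p1 + p2].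
Proof.
elim=> [k|_ [v vs ->]|p p' _ [p1 [p2 [g1 g2 e]]] _ [p1' [p2' [g1' g2' e']]]
  |p p' gp [p1 [p2 [g1 g2 e]]] gp' [p1' [p2' [g1' g2' e']]]].
- exists k%:A, 0; split; first exact: gen_scalar.
  + by rewrite -(scale0r (1 : A)); exact: gen_scalar.
  + by rewrite mulr_algl mulr_algr addr0.
- have gv : seq_gen s (iota v) by apply: gen_in; exists v.
  exists (-1 *: iota v), (polar v u)%:A; split; first exact: gen_scale.
  + exact: gen_scalar.
  + by rewrite scaleN1r mulrN iota_anticomm addrC.
- exists (p1 + p1'), (p2 + p2'); split; [exact: gen_add|exact: gen_add|].
  by rewrite mulrDl e e' mulrDr addrACA.
- exists (p1 * p1'), (p2 * p1' + p * p2'); split; first exact: gen_mul.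
  + by apply: gen_add; exact: gen_mul.
  + by rewrite -mulrA e' mulrDr mulrA e mulrDl -!mulrA addrA.
Qed.

(** As [iota u] can be moved to the left and squares to a scalar, one occurrence of it suffices. *)
Lemma seq_gen_peel s (u : V) x : seq_gen (u :: s) x ->
  exists p q, [/\ seq_gen s p, seq_gen s q & x = p + iota u * q].
Proof.
have g0 : seq_gen s 0 by rewrite -(scale0r (1 : A)); exact: gen_scalar.
have g1 : seq_gen s 1 by rewrite -(scale1r (1 : A)); exact: gen_scalar.
elim=> [k|_ [v + ->]|y z _ [p [q [gp gq ->]]] _ [p' [q' [gp' gq' ->]]]
  |y z _ [p [q [gp gq ->]]] _ [p' [q' [gp' gq' ->]]]].
- exists k%:A, 0; split=> //; first exact: gen_scalar.
  by rewrite mulr0 addr0.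
- rewrite inE => /orP[/eqP->|vs]; [exists 0, 1|exists (iota v), 0]; split=> //.
  + by rewrite add0r mulr1.
  + by apply: gen_in; exists v.
  + by rewrite mulr0 addr0.
- exists (p + p'), (q + q'); split; [exact: gen_add|exact: gen_add|].
  by rewrite mulrDr addrACA.
- have [p1 [p2 [gp1 gp2 ep]]] := seq_gen_commute u gp.
  have [q1 [q2 [gq1 gq2 eq]]] := seq_gen_commute u gq.
  (* Writing [U] for [iota u], expand [(p + U q)(p' + U q')] with [p U = U p1 + p2] and
     [q U = U q1 + q2], then replace [U U] by [f u]. *)
  exists (p * p' + (p2 * q' + f u *: (q1 * q'))), (p1 * q' + (q * p' + q2 * q')).
  split.
  + by do 2?[apply: gen_add]; try apply: gen_scale; exact: gen_mul.
  + by do 2?[apply: gen_add]; exact: gen_mul.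
  + rewrite mulrDl !mulrDr (mulrA p) ep -(mulrA _ q (iota u * q')) (mulrA q) eq.
    rewrite -[f u *: _]mulr_algl -iota2 !mulrDl !mulrDr !mulrA !addrA.
    rewrite -!addrA; congr (_ + _).
    move: (iota u * p1 * q') (p2 * q') (iota u * q * p') (_ * q1 * q') (_ * q2 * q') => a b c d e.
    by rewrite [LHS]addrCA [d + e]addrC; congr (_ + _); rewrite [RHS]addrC -!addrA.
Qed.

End Peeling.

(** * Parity and centralizers in a Clifford algebra *)

Section Centralizer.
Variables (K : fieldType) (V : lmodType K) (A : algType K).
Variables (iota : {linear V -> A}) (f : V -> K).
Hypothesis iotaP : is_clifford f iota.
Hypothesis two_neq0 : (2%:R : K) != 0.

Let iota2 : forall v, iota v * iota v = (f v)%:A := iotaP.1.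
Let B := polar f.

Lemma scalar_alg_inj (a b : K) : a%:A = b%:A :> A -> a = b.
Proof.
move=> /eqP; rewrite -subr_eq0 -scalerBl scaler_eq0 oner_eq0 orbF subr_eq0.
by move/eqP.
Qed.

Lemma polarE u v : (B u v)%:A = iota u * iota v + iota v * iota u.
Proof. by rewrite (iota_anticomm iota2) subrK. Qed.

(** Inherited from the linearity of [iota]: the scalar [B u t] is the anticommutator of [iota u] and
    [iota t], and scalars embed in [A]. *)
Lemma polar_linearl a u v t : B (a *: u + v) t = a * B u t + B v t.
Proof.
apply: scalar_alg_inj; rewrite [RHS]scalerDl -scalerA !polarE linearP /=.
by rewrite mulrDl mulrDr scalerDr -scalerAl -scalerAr addrACA.
Qed.

Lemma polar_linearr a u v t : B t (a *: u + v) = a * B t u + B t v.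
Proof.
apply: scalar_alg_inj; rewrite [RHS]scalerDl -scalerA !polarE linearP /=.
by rewrite mulrDl mulrDr scalerDr -scalerAl -scalerAr addrACA.
Qed.

(** The map [- iota] satisfies the same relation, so it extends to an endomorphism, whose square
    fixes every [iota v] and is the identity by uniqueness. *)
Lemma clifford_parity : exists s : {lrmorphism A -> A},
  (forall v, s (iota v) = - iota v) /\ (forall x, s (s x) = x).
Proof.
have neg2 v : (\- iota) v * (\- iota) v = (f v)%:A by rewrite /= mulrNN iota2.
have [s [s_iota _]] := iotaP.2 _ (\- iota) neg2.
have [h0 [_ h0_uniq]] := iotaP.2 _ iota iota2.
exists s; split=> // x.
rewrite [RHS](h0_uniq idfun) // -(h0_uniq (s \o s)) // => v /=.
by rewrite s_iota /= rmorphN /= s_iota opprK.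
Qed.

Variable s : {lrmorphism A -> A}.
Hypothesis s_iota : forall v, s (iota v) = - iota v.
Hypothesis sK : involutive s.

Lemma seq_gen_orthogonal r y q : (forall v, v \in r -> B y v = 0) ->
  seq_gen iota r q -> iota y * q = s q * iota y.
Proof.
move=> yr; elim=> [k|_ [v /yr yv ->]|x z _ ex _ ez|x z _ ex _ ez].
- by rewrite linearZ /= rmorph1 mulr_algl mulr_algr.
- by rewrite s_iota (iota_anticomm iota2) -/(B _ _) yv scale0r add0r mulNr.
- by rewrite mulrDr ex ez rmorphD mulrDl.
- by rewrite mulrA ex -mulrA ez mulrA rmorphM.
Qed.

(* Gaussian elimination: the forms [B y] with [y] in [Y] separate [u] from [r]. *)
Lemma separating_vector (Y : V -> Prop) r u :
    (forall a y y', Y y -> Y y' -> Y (a *: y + y')) ->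
    (forall v, (forall y, Y y -> B y v = 0) -> v = 0) ->
  seq_gen iota r (iota u) \/
  exists y, [/\ Y y, forall v, v \in r -> B y v = 0 & B y u != 0].
Proof.
move=> Ylin Ysep; elim: r u => [|v r IHr] u.
  have [[y Yy Byu]|noY] := pselect (exists2 y, Y y & B y u != 0).
    by right; exists y.
  left; suff -> : u = 0.
    by rewrite linear0 -(scale0r (1 : A)); exact: gen_scalar.
  apply: Ysep => y Yy; apply/eqP; apply: contrapT => /negP nz.
  by apply: noY; exists y.
have r_cons x : seq_gen iota r x -> seq_gen iota (v :: r) x.
  by apply: gen_sub => _ [z zr ->]; exists z => //; rewrite inE zr orbT.
case: (IHr v) => [vr|[y' [Yy' y'r y'v]]].
  case: (IHr u) => [ur|[y [Yy yr yu]]]; first by left; exact: r_cons.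
  right; exists y; split=> // z; rewrite inE => /orP[/eqP ->|]; last exact: yr.
  (* Since [iota v] is generated by [r], graded commutation makes [iota y] anticommute with it, so
     [B y v = 0]. *)
  apply: scalar_alg_inj; rewrite polarE (seq_gen_orthogonal yr vr) s_iota.
  by rewrite mulNr addNr scale0r.
(* This [c] makes [- c *: v + u] orthogonal to [y']. *)
pose c := B y' u / B y' v.
case: (IHr (- c *: v + u)) => [ur|[y [Yy yr yu]]].
  left; have -> : iota u = iota (- c *: v + u) + c *: iota v.
    by rewrite linearP /= scaleNr addrAC addNr add0r.
  apply: gen_add; first exact: r_cons.
  by apply/gen_scale/gen_in; exists v => //; rewrite mem_head.
(* The multiple of [y'] cancels the value at [v]; the value at [u] becomes [B y (- c *: v + u)],
   which is nonzero. *)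
right; exists (- (B y v / B y' v) *: y' + y); split; first exact: Ylin.
- move=> z; rewrite inE polar_linearl => /orP[/eqP ->|zr].
    by rewrite mulNr divfK // addNr.
  by rewrite (yr _ zr) (y'r _ zr) mulr0 addr0.
- move: yu; rewrite polar_linearl polar_linearr /c.
  by rewrite !mulNr mulrAC [B y v / _ * _]mulrAC [B y v * _]mulrC.
Qed.

Lemma even_centralizer (Y : V -> Prop) x :
    (forall v, (forall y, Y y -> B y v = 0) -> v = 0) ->
    (forall y, Y y -> GRing.comm x (iota y)) -> s x = x ->
  exists k, x = k%:A.
Proof.
move=> Ysep xY sx.
(* [Y] is enlarged to all vectors whose images commute with [x], a set closed under linear
   combinations as [separating_vector] requires. *)
pose Z v := iota v * x = x * iota v.
have Zlin a y y' : Z y -> Z y' -> Z (a *: y + y').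
  rewrite /Z linearP /= mulrDl mulrDr -scalerAl => -> ->.
  by rewrite -scalerAr.
have Zsep v : (forall y, Z y -> B y v = 0) -> v = 0.
  by move=> Zv; apply: Ysep => y /xY xy; exact: Zv.
have [S [fS]] : exists S : set V, finite_set S /\
    gen (fun y => exists2 v, S v & y = iota v) x.
  apply: gen_image_finite; apply: gen_sub (clifford_gen x iotaP).
  by move=> _ [v _ ->]; exists v.
have /finite_seqP[r ->] := fS.
move=> gx; have {gx fS} : seq_gen iota r x := gx.
elim: r => [|u r IHr] gx.
  elim: {Zlin Zsep Z sx xY} gx => [k|_ [v //]|y z _ [k ->] _ [l ->]|y z _ [k ->] _ [l ->]].
  - by exists k.
  - by exists (k + l); rewrite scalerDl.
  - by exists (k * l); rewrite mulr_algl scalerA.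
have [p [q [gp gq ex]]] := seq_gen_peel iota2 gx.
apply: IHr.
have [ur|[y [Zy yr yu]]] := separating_vector r u Zlin Zsep.
  by rewrite ex; apply: gen_add => //; exact: gen_mul.
suff q0 : q = 0 by rewrite ex q0 mulr0 addr0.
(* In [iota y * x = s x * iota y] the [p] terms cancel by graded commutation. So do the terms
   [iota u * s q * iota y], leaving [B y u *: q = 0]. *)
have := Zy; rewrite /Z -{2}sx ex mulrDr (seq_gen_orthogonal yr gp).
rewrite rmorphD rmorphM /= s_iota mulrDl => /addrI.
rewrite mulrA (iota_anticomm iota2) mulrBl -[iota u * _ * q]mulrA (seq_gen_orthogonal yr gq).
rewrite mulNr mulNr mulrA -[RHS]add0r => /addIr /eqP.
by rewrite mulr_algl scaler_eq0 -/(B y u) (negPf yu) => /eqP.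
Qed.

Lemma anticommuting_not_comm (x y : A) : x * x = -1 -> y * y = -1 ->
  x * y = - (y * x) -> ~ GRing.comm x y.
Proof.
move=> xx yy xy; rewrite /GRing.comm xy => /eqP.
rewrite eq_sym -addr_eq0 -mulr2n -scaler_nat scaler_eq0 (negPf two_neq0) /=.
(* With [y x = 0], one gets [1 = (y y)(x x) = y (y x) x = 0]. *)
move=> /eqP yx0; have := oner_neq0 A.
by rewrite -[1]mulr1 -mulrNN -{1}yy -xx mulrA -(mulrA y) yx0 mulr0 mul0r eqxx.
Qed.

(** The even element [x + s x] also centralizes [Y], so it is a scalar [k]. If [k] is nonzero,
    applying [s] to [x * x = -1] gives [(k - x)^2 = -1], hence [x = k / 2]. *)
Lemma sqrtN1_odd (Y : V -> Prop) x :
    (forall v, (forall y, Y y -> B y v = 0) -> v = 0) ->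
    (forall y, Y y -> GRing.comm x (iota y)) -> x * x = -1 ->
  s x = - x \/ exists k, x = k%:A.
Proof.
move=> Ysep xY xx.
have [y Yy||k ek] := even_centralizer (x := x + s x) Ysep.
- apply/commr_sym/commrD; apply/commr_sym; first exact: xY.
  have /(congr1 s) := xY y Yy; rewrite !rmorphM /= s_iota mulrN mulNr.
  exact: oppr_inj.
- by rewrite rmorphD /= sK addrC.
have sx : s x = k%:A - x by rewrite -ek addrC addKr.
have [k0|k0] := eqVneq k 0; first by left; rewrite sx k0 scale0r sub0r.
right; exists (k / 2%:R).
have := congr1 s xx; rewrite rmorphM rmorphN1 /= sx.
rewrite mulrBl !mulrBr xx mulr_algl mulr_algr mulr_algl => /eqP.
rewrite -subr_eq0 opprK opprD addrA subrK -addrA -opprD subr_eq0 => /eqP e.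
apply: (@scalerI _ _ (2%:R * k)); first by rewrite mulf_neq0.
rewrite -[LHS]scalerA [LHS]scaler_nat mulr2n -e !scalerA; congr (_ *: _).
by rewrite [2%:R * k]mulrC mulrACA mulfV // mulr1.
Qed.

(** A scalar commutes with everything. If both elements are odd, their product is even, hence a
    scalar [k], and [y = - k *: x] commutes with [x]. *)
Lemma no_anticommuting_pair (Y : V -> Prop) x y :
    (forall v, (forall y, Y y -> B y v = 0) -> v = 0) ->
    (forall v, Y v -> GRing.comm x (iota v)) ->
    (forall v, Y v -> GRing.comm y (iota v)) ->
  x * x = -1 -> y * y = -1 -> x * y = - (y * x) -> False.
Proof.
move=> Ysep xY yY xx yy xy; apply: (anticommuting_not_comm xx yy xy).
have [sx|[k ->]] := sqrtN1_odd Ysep xY xx; last first.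
  by rewrite /GRing.comm mulr_algl mulr_algr.
have [sy|[k ->]] := sqrtN1_odd Ysep yY yy; last first.
  by rewrite /GRing.comm mulr_algl mulr_algr.
have [v Yv||k ek] := even_centralizer (x := x * y) Ysep.
- by apply/commr_sym/commrM; apply/commr_sym; [exact: xY|exact: yY].
- by rewrite rmorphM /= sx sy mulrNN.
have -> : y = - k *: x.
  by rewrite scaleNr -mulr_algr -ek mulrA xx mulN1r opprK.
by rewrite /GRing.comm -scalerAl -scalerAr.
Qed.

End Centralizer.

(** * Square-summable sequences and their sum of squares *)

Section SquareSummable.
Variable R : realType.
Local Open Scope classical_set_scope.
Local Open Scope ring_scope.
Local Notation C := (R[i]).
Implicit Types (a b : nat -> C) (u v z : nat -> R).

Lemma cvg_series_delta (c : R) n :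
  series (fun i => c *+ (i == n)) @ \oo --> c.
Proof.
apply: cvg_near_cst; near=> m.
rewrite /series /= (bigD1_seq n) ?iota_uniq //=; last first.
  by rewrite mem_index_iota /=; near: m; exact: nbhs_infty_gt.
by rewrite eqxx big1 ?addr0 // => i /negPf ->.
Unshelve. all: by end_near. Qed.

Lemma lim_series_add3 u v z (l : R) : cvgn (series u) -> cvgn (series v) ->
    series z @ \oo --> l ->
  limn (series (fun i => u i + v i + z i)) = limn (series u) + limn (series v) + l.
Proof.
move=> cu cv cz; apply: cvg_lim => //.
have -> : series (fun i => u i + v i + z i) = series u \+ series v \+ series z.
  by apply/funext => n; rewrite /series /= !big_split.
by apply: cvgD => //; exact: cvgD.
Qed.

(** Comparison test: for [a i = x + i y], both [|x^2 - y^2|] and [|2 x y|] are at most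
    [x^2 + y^2]. *)
Lemma sq_summable_cvg a : sq_summable a ->
  cvgn (series (fun i => complex.Re (a i ^+ 2))) /\
  cvgn (series (fun i => complex.Im (a i ^+ 2))).
Proof.
move=> sa; split; apply: normed_cvg; apply: series_le_cvg sa => //= i.
- by rewrite addr_ge0 // sqr_ge0.
- case: (a i) => x y; rewrite expr2 /= -!expr2.
  by rewrite (le_trans (ler_normB _ _)) // !ger0_norm ?sqr_ge0.
- by rewrite addr_ge0 // sqr_ge0.
- case: (a i) => x y; rewrite expr2 /= [y * x]mulrC ler_norml.
  have := sqr_ge0 (x + y); have := sqr_ge0 (x - y).
  rewrite sqrrB sqrrD => h1 h2; apply/andP; split; nra.
Qed.

Lemma sum_sq_add a b (l : C) : sq_summable a -> sq_summable b ->
    series (fun i => complex.Re (a i * b i *+ 2)) @ \oo --> complex.Re l ->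
    series (fun i => complex.Im (a i * b i *+ 2)) @ \oo --> complex.Im l ->
  sum_sq (fun i => a i + b i) = sum_sq a + sum_sq b + l.
Proof.
move=> /sq_summable_cvg[ra ia] /sq_summable_cvg[rb ib] rl il.
case: l rl il => lr li /= rl il.
rewrite /sum_sq; apply/eqP; rewrite eq_complex /=; apply/andP; split; apply/eqP.
- rewrite -(lim_series_add3 ra rb rl); congr (limn (series _)).
  apply/funext => i; rewrite sqrrD addrAC.
  by case: (a i ^+ 2) (b i ^+ 2) (a i * b i *+ 2) => [? ?] [? ?] [? ?].
- rewrite -(lim_series_add3 ia ib il); congr (limn (series _)).
  apply/funext => i; rewrite sqrrD addrAC.
  by case: (a i ^+ 2) (b i ^+ 2) (a i * b i *+ 2) => [? ?] [? ?] [? ?].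
Qed.

Definition delta_seq n : nat -> C := fun i => (i == n)%:R.

Lemma delta_seq_summable n : sq_summable (delta_seq n).
Proof.
rewrite /sq_summable; apply/cvg_ex; exists 1.
rewrite [X in series X](_ : _ = (fun i => 1 *+ (i == n))).
  exact: cvg_series_delta.
by apply/funext => i; rewrite /delta_seq; case: eqP => _ /=; rewrite ?expr1n expr0n addr0.
Qed.

(** Only the [n]-th cross term survives; this will show that the polar form against a coordinate
    vector reads off a coordinate. *)
Lemma sum_sq_delta_add n a : sq_summable a ->
  sum_sq (fun i => delta_seq n i + a i) = sum_sq (delta_seq n) + sum_sq a + a n *+ 2.
Proof.
move=> sa; apply: sum_sq_add => //; first exact: delta_seq_summable.
- rewrite [X in series X](_ : _ = (fun i => complex.Re (a n *+ 2) *+ (i == n))).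
    exact: cvg_series_delta.
  by apply/funext => i; rewrite /delta_seq; case: eqP => [->|_]; rewrite ?mul1r // mul0r mul0rn.
- rewrite [X in series X](_ : _ = (fun i => complex.Im (a n *+ 2) *+ (i == n))).
    exact: cvg_series_delta.
  by apply/funext => i; rewrite /delta_seq; case: eqP => [->|_]; rewrite ?mul1r // mul0r mul0rn.
Qed.

Lemma geometric_summable (t : R) : 0 < t < 1 -> sq_summable (fun i => (t ^+ i)%:C%C).
Proof.
move=> /andP[t0 t1]; rewrite /sq_summable.
rewrite [X in series X](_ : _ = geometric 1 (t ^+ 2)); last first.
  by apply/funext => i; rewrite /= expr0n addr0 mul1r -!exprM mulnC.
apply: is_cvg_geometric_series.
by rewrite ger0_norm ?sqr_ge0 // expr_lt1 // ltW.
Qed.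

End SquareSummable.

(** * Uncountable dimension of the space of square-summable sequences *)

Lemma vandermonde_combination (K : fieldType) n (t c : 'I_n -> K) :
  injective t -> (forall i, \sum_k c k * t k ^+ i = 0) -> forall k, c k = 0.
Proof.
move=> t_inj ct k.
pose M := Vandermonde n (\row_j t j).
have uM : M^T \in unitmx.
  rewrite unitmxE det_tr det_Vandermonde unitfE.
  apply/prodf_neq0 => i _; apply/prodf_neq0 => j ij.
  rewrite !mxE subr_eq0; apply: contraTneq ij => /t_inj ->.
  by rewrite ltnn.
have cM : (\row_j c j) *m M^T = 0.
  apply/rowP => i; rewrite !mxE -[RHS](ct i).
  by apply: eq_bigr => j _; rewrite !mxE.
have := mulmxK uM (\row_j c j); rewrite cM mul0mx => /rowP/(_ k).
by rewrite !mxE.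
Qed.

Lemma vanishing_row (K : fieldType) n (M : 'M[K]_(n.+1, n)) :
  exists2 c : 'rV_n.+1, c != 0 & c *m M = 0.
Proof.
have : kermx M != 0.
  by rewrite kermx_eq0 /row_free neq_ltn ltnS rank_leq_col.
case/rowV0Pn => c /sub_kermxP cM c0; by exists c.
Qed.

Section UncountableDimension.
Variables (R : realType) (V : lmodType R[i]) (e : V -> nat -> R[i]).
Hypothesis e_lin : forall (c : R[i]) (u v : V),
  e (c *: u + v) = (fun n => c * e u n + e v n).
Hypothesis e_img : forall a : nat -> R[i], sq_summable a <-> exists v : V, e v = a.

Lemma coord_add u v n : e (u + v) n = e u n + e v n.
Proof. by rewrite -[u in LHS]scale1r e_lin mul1r. Qed.

Lemma coord0 n : e 0 n = 0.
Proof. by apply: (@addIr _ (e 0 n)); rewrite -coord_add addr0 add0r. Qed.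

Lemma coord_sum m (a : 'I_m -> R[i]) (v : 'I_m -> V) n :
  e (\sum_k a k *: v k) n = \sum_k a k * e (v k) n.
Proof.
elim/big_rec2: _ => [|k x y _ <-]; first exact: coord0.
by rewrite e_lin.
Qed.

Definition in_initial_span (b : nat -> V) n (v : V) : Prop :=
  exists a : 'I_n -> R[i], v = \sum_(j < n) a j *: b j.

Definition is_geometric (t : R) (v : V) : Prop :=
  e v = (fun i => (t ^+ i)%:C%C).

(** Otherwise take [n.+1] such vectors with distinct ratios. Their coefficient rows of length [n]
    are dependent, and the resulting relation between geometric sequences contradicts
    Vandermonde. *)
Lemma finite_geometric_in_span (b : nat -> V) n :
  finite_set [set t | exists2 v, is_geometric t v & in_initial_span b n v]%classic.
Proof.
apply: contrapT => /infiniteP/pcard_leP[f].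
have /choice[v fv] (k : 'I_n.+1) : exists va : V * ('I_n -> R[i]),
    is_geometric (f k) va.1 /\ va.1 = \sum_(j < n) va.2 j *: b j.
  by have [v gv [a va]] : _ := @funS _ _ _ _ f k I; exists (v, a).
have [c c0 cM] := vanishing_row (\matrix_(k < n.+1, j < n) (v k).2 j).
move/eqP: c0; apply; apply/rowP => k; rewrite mxE.
apply: (@vandermonde_combination _ n.+1 (fun k : 'I_n.+1 => (f k)%:C%C) (c 0)).
  move=> i j [] /(@inj _ _ _ f) ij; apply: val_inj; apply: ij; exact: in_setT.
move=> i; rewrite -[RHS](coord0 i).
have <- : \sum_k c 0 k *: (v k).1 = 0.
  under eq_bigr => l _ do rewrite (fv l).2 scaler_sumr.
  rewrite exchange_big big1 // => j _.
  under eq_bigr => l _ do rewrite scalerA.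
  rewrite -scaler_suml; move/rowP/(_ j): cM; rewrite !mxE.
  under eq_bigr => l _ do rewrite mxE.
  by move=> ->; rewrite scale0r.
rewrite coord_sum; apply: eq_bigr => l _.
by rewrite (fv l).1 rmorphXn.
Qed.

(** A countable spanning family would make []0, 1[] a countable union of finite sets of ratios, yet
    its Lebesgue measure is 1. *)
Lemma spans_uncountable (I : Type) (b : I -> V) :
  spans b -> ~ countable [set: I]%classic.
Proof.
move=> b_spans /countable_injP[c c_inj].
(* [b'] is [b] reindexed by natural numbers through the injection [c], with [0] allowed at values
   that [c] misses. *)
have /choice[b' bb'] j : exists u, forall i, c i = j -> u = b i.
  have [[i <-]|noi] := pselect (exists i, c i = j); last first.
    by exists 0 => i ij; case: noi; exists i.
  by exists (b i) => i' /c_inj -> //; exact: in_setT.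
have span_b' v : exists n, in_initial_span b' n v.
  have [m [idx [a ->]]] := b_spans v.
  exists (\max_(k < m) c (idx k)).+1.
  (* [idx] may repeat an index, so the coefficients landing on the same [j] are added. *)
  exists (fun j => \sum_k a k *+ (j == c (idx k) :> nat)).
  under [RHS]eq_bigr => j _ do rewrite scaler_suml.
  rewrite exchange_big; apply: eq_bigr => k _ /=.
  have lek : (c (idx k) < (\max_(k < m) c (idx k)).+1)%N.
    by rewrite ltnS; exact: (leq_bigmax k).
  rewrite (bigD1 (Ordinal lek)) //= eqxx (bb' _ (idx k)) // big1 ?addr0 // => j.
  by rewrite -val_eqE /= => /negPf ->; rewrite scale0r.
pose T n := [set t | exists2 v, is_geometric t v & in_initial_span b' n v]%classic.
have cT : countable (\bigcup_n T n)%classic.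
  apply: bigcup_countable => // n _; apply: finite_set_countable.
  exact: finite_geometric_in_span.
have : countable (`]0, 1[%classic : set R).
  apply: sub_countable cT; apply: subset_card_le => t /=.
  rewrite in_itv /= => /geometric_summable/e_img[v ev].
  by have [n nv] := span_b' v; exists n => //; exists v.
move/countable_lebesgue_measure0; rewrite lebesgue_measure_itv /= lte_fin ltr01.
by rewrite oppr0 addr0 => /eqP; rewrite eqe oner_eq0.
Qed.

End UncountableDimension.

(** * Choosing indices outside a countable set *)

Lemma uncountable_avoid (I : Type) (J : set I) :
  ~ countable [set: I]%classic -> countable J -> exists i, ~ J i.
Proof.
move=> ncI cJ; apply: contrapT => noi; apply: ncI; apply: sub_countable cJ.
by apply: subset_card_le => i _; apply: contrapT => nJi; apply: noi; exists i.
Qed.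

Lemma uncountable_avoid3 (I : Type) (J : set I) :
    ~ countable [set: I]%classic -> countable J ->
  exists i j k, [/\ i <> j, i <> k & j <> k] /\ [/\ ~ J i, ~ J j & ~ J k].
Proof.
move=> ncI cJ.
have cU1 (D : set I) i : countable D -> countable (D `|` [set i])%classic.
  move=> cD; have : countable (\bigcup_(x : bool) if x then D else [set i])%classic.
    by apply: bigcup_countable => // -[].
  apply: sub_countable; apply: subset_card_le.
  by move=> k [Dk|ik]; [exists true|exists false].
have [i Ji] := uncountable_avoid ncI cJ.
have [j /not_orP[Jj ji]] := uncountable_avoid ncI (cU1 _ i cJ).
have [k /not_orP[/not_orP[Jk ki] kj]] :=
  uncountable_avoid ncI (cU1 _ j (cU1 _ i cJ)).
exists i, j, k; split; split=> // e; [exact: ji|exact: ki|exact: kj].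
Qed.

(** * Products of orthonormal generators *)

Section OrthonormalClifford.
Variables (K : fieldType) (W : lmodType K) (I : Type) (w : I -> W) (g : W -> K).
Hypothesis g_def : forall (n : nat) (idx : 'I_n -> I) (a : 'I_n -> K),
  injective idx -> g (\sum_(k < n) a k *: w (idx k)) = \sum_(k < n) a k ^+ 2.
Variables (B : algType K) (iB : {linear W -> B}).
Hypothesis iB2 : forall v, iB v * iB v = (g v)%:A.
Let b i := iB (w i).

Lemma orthonormal_sqr i : b i * b i = 1.
Proof.
have inj1 : injective (fun _ : 'I_1 => i) by move=> x y _; rewrite !ord1.
have := g_def (fun _ => 1) inj1.
by rewrite !big_ord1 scale1r expr1n /b iB2 => ->; rewrite scale1r.
Qed.

Lemma orthonormal_anticomm i j : i <> j -> b i * b j = - (b j * b i).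
Proof.
move=> ij.
have inj2 : injective (fun k : 'I_2 => if k == ord0 then i else j).
  move=> [[|[|x]] px] // [[|[|y]] py] //; rewrite -?val_eqE /= => eij;
    by [apply: val_inj | case: ij].
have := g_def (fun _ => 1) inj2.
rewrite !big_ord_recl !big_ord0 /= !scale1r !addr0 expr1n => gij.
have := iB2 (w i + w j); rewrite gij linearD /= mulrDl !mulrDr.
rewrite -/(b i) -/(b j) !orthonormal_sqr scalerDl !scale1r.
rewrite [b j * b i + 1]addrC addrACA -[RHS]addr0 => /addrI/eqP.
by rewrite addr_eq0 => /eqP.
Qed.

Lemma orthonormal_pair_comm i j k : i <> j -> i <> k ->
  GRing.comm (b j * b k) (b i).
Proof.
move=> ij ik; apply/commr_sym.
rewrite /GRing.comm mulrA (orthonormal_anticomm ij) mulNr -!mulrA.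
by rewrite (orthonormal_anticomm ik) mulrN opprK.
Qed.

Lemma orthonormal_pair_sqr i j : i <> j -> (b i * b j) * (b i * b j) = -1.
Proof.
move=> ij; rewrite {1}(orthonormal_anticomm ij) mulNr -mulrA (mulrA (b i)).
by rewrite orthonormal_sqr mul1r orthonormal_sqr.
Qed.

(** The pairs share [j]: the left product collapses to [b i * b k], while the reversed one picks up
    one sign from exchanging [b k] and [b j]. *)
Lemma orthonormal_pairs_anticomm i j k : i <> j -> i <> k -> j <> k ->
  (b i * b j) * (b j * b k) = - ((b j * b k) * (b i * b j)).
Proof.
move=> ij ik jk; rewrite -mulrA (mulrA (b j)) orthonormal_sqr mul1r.
rewrite mulrA (orthonormal_pair_comm ij ik) -!mulrA (orthonormal_anticomm (nesym jk)).
by rewrite !mulrN opprK (mulrA (b j)) orthonormal_sqr mul1r.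
Qed.

End OrthonormalClifford.

(** * Transport of an anticommuting pair from [B] to [A] *)

Theorem theorem9 (R : realType)
  (* V is (a C-vector space identified, via the linear bijection e, with) l^2 *)
  (V : lmodType R[i]) (e : V -> nat -> R[i]) (f : V -> R[i])
  (e_lin : forall (c : R[i]) (u v : V), e (c *: u + v) = (fun n => c * e u n + e v n))
  (e_inj : injective e)
  (e_img : forall a : nat -> R[i], sq_summable a <-> exists v : V, e v = a)
  (f_def : forall v : V, f v = sum_sq (e v))
  (* |I| = dim_C V *)
  (I : Type) (bV : I -> V) (bV_basis : hamel_basis bV)
  (* W with basis (w_i)_{i in I} and the quadratic form g *)
  (W : lmodType R[i]) (w : I -> W) (w_basis : hamel_basis w) (g : W -> R[i])
  (g_def : forall (n : nat) (idx : 'I_n -> I) (a : 'I_n -> R[i]), injective idx ->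
     g (\sum_(k < n) a k *: w (idx k)) = \sum_(k < n) a k ^+ 2)
  (* A = Cl(V, f), B = Cl(W, g) *)
  (A : algType R[i]) (iA : {linear V -> A}) (A_cl : is_clifford f iA)
  (B : algType R[i]) (iB : {linear W -> B}) (B_cl : is_clifford g iB) :
  ~ (exists h : {lrmorphism A -> B}, bijective h).
Proof.
case=> h [h' h'K hK'].
have two_neq0 : (2%:R : R[i]) != 0 by rewrite pnatr_eq0.
have [s [s_iota sK]] := clifford_parity A_cl.
have /choice[d ed] (n : nat) := (e_img (delta_seq R n)).1 (@delta_seq_summable R n).
have polar_d n v : polar f (d n) v = e v n *+ 2.
  have sv : sq_summable (e v) by apply/e_img; exists v.
  rewrite /polar !f_def ed.
  have -> : e (d n + v) = (fun i => delta_seq R n i + e v i).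
    by apply/funext => i; rewrite (coord_add e_lin) ed.
  by rewrite sum_sq_delta_add //; ring.
have d_sep v : (forall y, (exists n, y = d n) -> polar f y v = 0) -> v = 0.
  move=> dv; apply: e_inj; apply/funext => n; rewrite (coord0 e_lin).
  have := dv (d n) (ex_intro _ n erefl); rewrite polar_d => /eqP.
  by rewrite -mulr_natl mulf_eq0 (negPf two_neq0) => /eqP.
have genB y : gen (fun z => exists i, z = iB (w i)) y.
  apply: gen_trans (clifford_gen y B_cl) => _ [v _ ->].
  have [n [idx [a ->]]] := w_basis.2 v.
  rewrite linear_sum; apply: gen_sum => k; rewrite linearZ.
  by apply/gen_scale/gen_in; exists (idx k).
have /choice[S S_gen] (n : nat) := gen_image_finite (genB (h (iA (d n)))).
have cS : countable (\bigcup_n S n)%classic.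
  apply: bigcup_countable => [|n _]; first exact: countableP.
  exact: finite_set_countable (S_gen n).1.
have ncI := spans_uncountable e_lin e_img bV_basis.2.
have [i [j [k [[ij ik jk] [Si Sj Sk]]]]] := uncountable_avoid3 ncI cS.
pose b i := iB (w i).
have h'_comm p q : ~ (\bigcup_n S n)%classic p -> ~ (\bigcup_n S n)%classic q ->
    forall v, (exists n, v = d n) -> GRing.comm (h' (b p * b q)) (iA v).
  move=> Sp Sq _ [n ->]; apply: (can_inj h'K); rewrite !rmorphM /= hK'.
  apply: gen_comm (S_gen n).2 => _ [l Sl ->].
  by apply: (orthonormal_pair_comm g_def B_cl.1) => le; [apply: Sp|apply: Sq];
    exists n => //; rewrite -le.
apply: (no_anticommuting_pair A_cl two_neq0 s_iota sK d_sep
  (h'_comm i j Si Sj) (h'_comm j k Sj Sk)); apply: (can_inj h'K).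
- by rewrite rmorphM /= hK' rmorphN1 (orthonormal_pair_sqr g_def B_cl.1).
- by rewrite rmorphM /= hK' rmorphN1 (orthonormal_pair_sqr g_def B_cl.1).
- by rewrite rmorphN /= !rmorphM /= !hK' (orthonormal_pairs_anticomm g_def B_cl.1).
Qed.
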